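(* Let $(X,\tau)$ be a topological metrizable space. Then $$\upsilon X=\bigvee\big\{H(Lip_d(X)): d\text{ is a metric on }X\text{ with }\tau_d=\tau\big\},$$ where $\tau_d$ denotes the topology induced by $d$.
   Context: A realcompactification of $X$ is a realcompact Tychonoff space containing $X$ as a dense subspace. $\alpha_1X\le\alpha_2X$ means that there is a continuous map $\alpha_2X\to\alpha_1X$ leaving $X$ pointwise fixed; $\alpha_1X$ and $\alpha_2X$ are equivalent if $\alpha_1X\le\alpha_2X\le\alpha_1X$. Realcompactifications are considered up to equivalence, and $\bigvee$ is the supremum for this order. $\upsilon X$ is the Hewitt-Nachbin realcompactification of $X$: the (unique up to equivalence) smallest realcompactification of $X$ to which every continuous function $X\to\mathbb{R}$ extends continuously (with real values). For a metric $d$ on $X$ inducing $\tau$, $Lip_d(X)$ is the unital vector lattice of all real-valued $d$-Lipschitz functions on $X$, and the Lipschitz realcompactification $H(Lip_d(X))$ is the space of unital vector lattice homomorphisms $Lip_d(X)\to\mathbb{R}$ with the topology of pointwise convergence ($X$ embedded via evaluations); equivalently, it is the smallest realcompactification of $X$ to which every $f\in Lip_d(X)$ extends to a continuous real-valued function. *)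

(* Defs.v *)
From HB Require Import structures.
From mathcomp Require Import all_boot all_order all_algebra.
From mathcomp Require Import all_classical all_reals all_analysis.

Set Implicit Arguments.
Unset Strict Implicit.
Unset Printing Implicit Defensive.

Import Order.TTheory GRing.Theory Num.Theory.
Import numFieldNormedType.Exports.
Local Open Scope classical_set_scope.
Local Open Scope ring_scope.

Definition embedding (S T : topologicalType) (f : S -> T) : Prop :=
  injective f /\
  (forall A : set S, open A <-> exists2 B : set T, open B & f @^-1` B = A).

Definition tychonoff_space (T : topologicalType) : Prop :=
  hausdorff_space T /\ completely_regular_space T.

(* Realcompact = homeomorphic to a closed subspace of a power of the real
   line, with the product topology. *)
Definition realcompact (R : realType) (T : topologicalType) : Prop :=
  exists (I : Type) (j : T -> {ptws I -> R}), embedding j /\ closed (range j).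

(* A space together with a map from X into it; "containing X as a dense
   subspace" is rendered by the embedding and density conditions of
   [is_realcompactification] below. *)
Record extension (X : topologicalType) := Extension {
  ext_space :> topologicalType;
  ext_map : X -> ext_space }.

Section Realcompactifications.
Variables (R : realType) (X : topologicalType).
Implicit Types Y Z : extension X.

Definition is_realcompactification Y : Prop :=
  [/\ tychonoff_space Y, realcompact R Y,
      embedding (@ext_map X Y) & dense (range (@ext_map X Y))].

Definition ext_le Y Z : Prop :=
  exists h : Z -> Y, continuous h /\ forall x, h (ext_map Z x) = ext_map Y x.

Definition extends_to Y (f : X -> R) : Prop :=
  exists g : Y -> R, continuous g /\ forall x, g (ext_map Y x) = f x.

Definition is_hewitt_nachbin Y : Prop :=
  [/\ is_realcompactification Y,
      forall f : X -> R, continuous f -> extends_to Y f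
    & forall Z, is_realcompactification Z ->
        (forall f : X -> R, continuous f -> extends_to Z f) -> ext_le Y Z].

(* [ext_le] is a preorder whose associated equivalence is the equivalence of
   realcompactifications, so a supremum is determined up to equivalence. *)
Definition is_supremum (S : extension X -> Prop) Y : Prop :=
  [/\ forall Z, S Z -> is_realcompactification Z,
      is_realcompactification Y,
      forall Z, S Z -> ext_le Z Y
    & forall W, is_realcompactification W ->
        (forall Z, S Z -> ext_le Z W) -> ext_le Y W].

End Realcompactifications.

Definition is_metric (R : realType) (X : Type) (d : X -> X -> R) : Prop :=
  [/\ forall x y, 0 <= d x y,
      forall x y, d x y = 0 <-> x = y,
      forall x y, d x y = d y x
    & forall x y z, d x z <= d x y + d y z].

(* The topology of X is the topology induced by d. *)
Definition induces_topology (R : realType) (X : topologicalType)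
    (d : X -> X -> R) : Prop :=
  forall A : set X, open A <->
    (forall x, A x -> exists2 e : R, 0 < e & [set y | d x y < e] `<=` A).

Definition metrizable (R : realType) (X : topologicalType) : Prop :=
  exists d : X -> X -> R, is_metric d /\ induces_topology d.

Section LipschitzFunctions.
Variables (R : realType) (X : Type) (d : X -> X -> R).
Implicit Types f g : X -> R.

Definition is_lipschitz f : Prop :=
  exists K : R, forall x y, `|f x - f y| <= K * d x y.

Definition Lip := set_type [set f : X -> R | is_lipschitz f].

Lemma is_lipschitz1 : is_lipschitz (fun=> 1).
Proof. by exists 0 => x y; rewrite subrr normr0 mul0r. Qed.

Lemma is_lipschitzD f g :
  is_lipschitz f -> is_lipschitz g -> is_lipschitz (fun x => f x + g x).
Proof.
move=> [K Kf] [L Lg]; exists (K + L) => x y.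
rewrite opprD addrACA mulrDl (le_trans (ler_normD _ _))//.
by rewrite lerD.
Qed.

Lemma is_lipschitzZ (a : R) f :
  is_lipschitz f -> is_lipschitz (fun x => a * f x).
Proof.
move=> [K Kf]; exists (`|a| * K) => x y.
by rewrite -mulrBr normrM -mulrA ler_wpM2l.
Qed.

Lemma is_lipschitz_abs f :
  is_lipschitz f -> is_lipschitz (fun x => `|f x|).
Proof.
move=> [K Kf]; exists K => x y.
exact: le_trans (ler_dist_dist _ _) (Kf x y).
Qed.

Lemma is_lipschitz_max f g :
  is_lipschitz f -> is_lipschitz g ->
  is_lipschitz (fun x => Num.max (f x) (g x)).
Proof.
move=> lf lg.
have lB : is_lipschitz (fun x => f x + -1 * g x).
  exact/is_lipschitzD/is_lipschitzZ.
have := is_lipschitzZ 2^-1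
  (is_lipschitzD (is_lipschitzD lf lg) (is_lipschitz_abs lB)).
congr is_lipschitz; apply/funext => x.
by rewrite maxr_absE mulN1r mulrC.
Qed.

Lemma is_lipschitz_min f g :
  is_lipschitz f -> is_lipschitz g ->
  is_lipschitz (fun x => Num.min (f x) (g x)).
Proof.
move=> lf lg.
have lN h : is_lipschitz h -> is_lipschitz (fun x => -1 * h x).
  exact: is_lipschitzZ.
have := lN _ (is_lipschitz_max (lN _ lf) (lN _ lg)).
congr is_lipschitz; apply/funext => x.
by rewrite !mulN1r oppr_max !opprK.
Qed.

Definition mkLip f (lf : is_lipschitz f) : Lip := SigSub (mem_set lf).

Definition lip1 : Lip := mkLip is_lipschitz1.
Definition lipD (u v : Lip) : Lip :=
  mkLip (is_lipschitzD (set_valP u) (set_valP v)).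
Definition lipZ (a : R) (u : Lip) : Lip :=
  mkLip (is_lipschitzZ a (set_valP u)).
Definition lip_max (u v : Lip) : Lip :=
  mkLip (is_lipschitz_max (set_valP u) (set_valP v)).
Definition lip_min (u v : Lip) : Lip :=
  mkLip (is_lipschitz_min (set_valP u) (set_valP v)).

Definition is_unital_vlattice_hom (phi : Lip -> R) : Prop :=
  [/\ phi lip1 = 1,
      forall u v, phi (lipD u v) = phi u + phi v,
      forall a u, phi (lipZ a u) = a * phi u,
      forall u v, phi (lip_max u v) = Num.max (phi u) (phi v)
    & forall u v, phi (lip_min u v) = Num.min (phi u) (phi v)].

Definition lip_eval (x : X) : {ptws Lip -> R} := fun u => val u x.

Lemma lip_eval_hom x : is_unital_vlattice_hom (lip_eval x).
Proof. by []. Qed.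

(* Carries the subspace topology of the product, i.e. the topology of
   pointwise convergence. *)
Definition HLip : topologicalType :=
  set_type [set phi : {ptws Lip -> R} | is_unital_vlattice_hom phi].

Definition HLip_eval (x : X) : HLip := SigSub (mem_set (lip_eval_hom x)).

End LipschitzFunctions.

Definition lipschitz_realcompactification (R : realType) (X : topologicalType)
    (d : X -> X -> R) : extension X :=
  Extension (@HLip_eval R X d).

(* Main.v *)
Require Import Defs.
From mathcomp Require Import all_boot all_order all_algebra.
From mathcomp Require Import all_classical all_reals all_analysis.
From mathcomp Require Import lra.

Set Implicit Arguments.
Unset Strict Implicit.
Unset Printing Implicit Defensive.

Import Order.TTheory GRing.Theory Num.Theory.
Import numFieldNormedType.Exports.
Local Open Scope classical_set_scope.
Local Open Scope ring_scope.

(** The supremum is the Hewitt-Nachbin realcompactification because every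
continuous function is Lipschitz for some compatible metric. If [d] induces
the topology and [f] is continuous, then the metric [graph_metric d f], that is
[d x y + |f x - f y|], still induces the topology, and [f] is 1-Lipschitz for
it; hence [f] extends to [H(Lip)] of that metric by evaluation of
homomorphisms. A realcompactification above all the Lipschitz ones therefore
extends every continuous function. Conversely, Lipschitz functions are
continuous, so a realcompactification [Z] that extends every continuous
function lies above every [H(Lip_d)] ([HLip_le]). The two families of
conditions on [Z] being equivalent, so are the two minimality properties.

What remains is that these objects exist and are realcompactifications. Both
[H(Lip_d)] and the Hewitt-Nachbin realcompactification are the closure of the
image of [X] in a power of the real line, under the evaluation map of a family
of continuous functions (the Lipschitz ones, resp. all of them); this is
studied once for an arbitrary family in the section [ClosureOfImage]. In the
Lipschitz case the family contains the functions [d a], which give the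
embedding, and the required identity between the set of unital vector lattice
homomorphisms and the closure of the set of evaluations is [hom_closure]. *)

(** * Powers of the real line *)

Lemma eval_continuous (R : realType) (I : Type) (i : I) :
  continuous (fun p : {ptws I -> R} => p i).
Proof. exact: (@proj_continuous {classic I} (fun=> R) i). Qed.

Lemma cvg_ptws (R : realType) (I T : Type) (F : set_system T)
    (h : T -> {ptws I -> R}) (p : {ptws I -> R}) : Filter F ->
  (forall i, h t i @[t --> F] --> p i) -> h @ F --> p.
Proof.
move=> FF hp; apply/cvg_sup => i U [_ [[W oW <-] /= Wp WU]].
by apply: (filterS WU); apply: hp; exact: open_nbhs_nbhs.
Qed.

Lemma hausdorff_separated (R : realType) (I : Type) (T : topologicalType)
    (f : I -> T -> R) : (forall i, continuous (f i)) ->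
  (forall s t, (forall i, f i s = f i t) -> s = t) -> hausdorff_space T.
Proof.
move=> cf sep s t st; apply: sep => i; apply: (@Rhausdorff R) => A B As Bt.
by have [z []] := st _ _ (cf i s _ As) (cf i t _ Bt); exists (f i z).
Qed.

(** * The closure of the image of a space in a power of the real line *)

Section ClosureOfImage.
Variables (R : realType) (X : topologicalType) (I : Type).
Variables (F : I -> X -> R) (C : set {ptws I -> R}).
Hypothesis Fcont : forall i, continuous (F i).

Let ev (x : X) : {ptws I -> R} := fun i => F i x.

Hypothesis C_closure : C = closure (range ev).

(** The map into the closure is a parameter, so that the results apply verbatim
to [HLip_eval], which is not built by corestriction to a closure. *)
Variable e : X -> set_type C.
Hypothesis eE : forall x, set_val (e x) = ev x.

Let Y : extension X := Extension e.

Lemma coord_continuous i : continuous (fun c : set_type C => set_val c i).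
Proof.
move=> c; apply: (@continuous_comp _ _ _ (set_val : set_type C -> _)
  (fun p : {ptws I -> R} => p i)); first exact: initial_continuous.
exact: eval_continuous.
Qed.

Lemma ext_map_continuous : continuous e.
Proof.
move=> x; apply: continuous_comp_initial => {}x.
rewrite (_ : _ \o e = ev); last by apply/funext => z; exact: eE.
by apply: cvg_ptws => i; exact: Fcont.
Qed.

Lemma closure_extends_to i : extends_to Y (F i).
Proof.
exists (fun c => set_val c i); split; first exact: coord_continuous.
by move=> x /=; rewrite eE.
Qed.

Lemma closure_range_dense : dense (range e).
Proof.
move=> O [c Oc] oO; case: (oO) => B oB BO.
have cC : closure (range ev) (set_val c) by rewrite -C_closure; exact: set_valP.
have Bc : nbhs (set_val c) B.
  by apply: open_nbhs_nbhs; split=> //; move: Oc; rewrite -BO.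
have [_ [[x _ <-] Bx]] := cC _ Bc.
by exists (e x); split; [rewrite -BO /= eE | exists x].
Qed.

Lemma closure_tychonoff : tychonoff_space (set_type C).
Proof.
split; last exact: uniform_completely_regular.
apply: (hausdorff_separated coord_continuous) => s t st.
by apply: val_inj; apply/funext.
Qed.

Lemma closure_realcompact : realcompact R (set_type C).
Proof.
exists I, set_val; split.
  by split; [exact: val_inj | move=> A; split=> -[B oB BA]; exists B].
suff -> : range (set_val : set_type C -> {ptws I -> R}) = C.
  by rewrite C_closure; exact: closed_closure.
apply/seteqP; split=> [_ [c _ <-]|c Cc]; first exact: set_valP.
by exists (SigSub (mem_set Cc)).
Qed.

(** For an open [A], an open set of the closure with preimage [A] is the union
of the slabs [|c i - F i x| < r] over all [x] and all [(i, r)] for which the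
slab around [F i x] pulls back into [A]. *)
Lemma closure_embedding :
  (forall x y, (forall i, F i x = F i y) -> x = y) ->
  (forall (A : set X) x, open A -> A x -> exists i, exists2 r : R, 0 < r &
     forall y, `|F i x - F i y| < r -> A y) ->
  embedding e.
Proof.
move=> Fsep Fopen; split.
  move=> x y exy; apply: Fsep => i.
  by rewrite -[LHS]/(ev x i) -eE exy eE.
move=> A; split=> [oA|[B oB <-]]; last first.
  by move/continuousP: ext_map_continuous; exact.
pose W (z : X * (I * R)) : set (set_type C) :=
  (fun c => set_val c z.2.1) @^-1` ball (F z.2.1 z.1) z.2.2.
pose D : set (X * (I * R)) :=
  [set z | forall y, `|F z.2.1 z.1 - F z.2.1 y| < z.2.2 -> A y].
exists (\bigcup_(z in D) W z).
  apply: bigcup_open => z _.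
  by apply: open_comp; [move=> c _; exact: coord_continuous | exact: ball_open].
apply/seteqP; split=> [y [z Dz]|x Ax].
  by rewrite /W /= eE; exact: Dz.
have [i [r r0 H]] := Fopen _ _ oA Ax.
by exists (x, (i, r)) => //; rewrite /W /= eE; exact: ballxx.
Qed.

Lemma closure_realcompactification :
  (forall x y, (forall i, F i x = F i y) -> x = y) ->
  (forall (A : set X) x, open A -> A x -> exists i, exists2 r : R, 0 < r &
     forall y, `|F i x - F i y| < r -> A y) ->
  is_realcompactification R Y.
Proof.
move=> Fsep Fopen; split; [exact: closure_tychonoff|
  exact: closure_realcompact| exact: closure_embedding|
  exact: closure_range_dense].
Qed.

(** The extensions of the [F i] to [Z] are the coordinates of a continuous map
from [Z] to the power of the real line; it sends the dense image of [X] into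
the image of the evaluation map, hence all of [Z] into its closure. *)
Lemma closure_ext_le (Z : extension X) :
  dense (range (@ext_map X Z)) -> (forall i, extends_to Z (F i)) ->
  ext_le Y Z.
Proof.
move=> Zdense /choice[g gF].
pose h (z : Z) : {ptws I -> R} := fun i => g i z.
have hcont : continuous h by move=> z; apply: cvg_ptws => i; exact: (gF i).1.
have hev x : h (ext_map Z x) = ev x by apply/funext => i; exact: (gF i).2.
have hC z : C (h z).
  rewrite C_closure => B /hcont hB.
  have zB : (h @^-1` B)^° !=set0 by exists z.
  have [_ [/[swap] [[x _ <-]] xB]] := Zdense _ zB (open_interior _).
  exists (ev x); split; first by exists x.
  by rewrite -hev; exact: (nbhs_singleton xB).
exists (fun z => SigSub (mem_set (hC z)) : set_type C); split.
  by move=> z; apply: continuous_comp_initial => {}z; exact: hcont.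
by move=> x; apply: val_inj; rewrite /= hev -[RHS]/(set_val (e x)) eE.
Qed.

End ClosureOfImage.

(** * Lattice homomorphisms as limits of evaluations *)

Lemma closure_range_eq (R : realType) (T : Type) (P : topologicalType)
    (e : T -> P) (f g : P -> R) (p : P) :
  continuous f -> continuous g -> (forall t, f (e t) = g (e t)) ->
  closure (range e) p -> f p = g p.
Proof.
move=> cf cg fg ep; apply: (@Rhausdorff R) => A B Afp Bgp.
have fA : nbhs p (f @^-1` A) by exact: cf.
have gB : nbhs p (g @^-1` B) by exact: cg.
have [_ [[t _ <-] [/= Ae Be]]] := ep _ (filterI fA gB).
by exists (f (e t)); split=> //; rewrite fg.
Qed.

Section LipHom.
Variables (R : realType) (X : Type) (d : X -> X -> R).
Implicit Types (u v w : Lip d) (phi : {ptws Lip d -> R}).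

Let lip_abs u := lip_max u (lipZ (-1) u).

(** If [|w|] were at least 1 everywhere, then [min(|w|, 1)] would be the unit,
whose value under [phi] is 1, whereas [phi w = 0] forces the value 0. *)
Lemma hom_meets_small phi w : is_unital_vlattice_hom phi -> phi w = 0 ->
  exists x, `|val w x| < 1.
Proof.
move=> [p1 pD pZ pM pm] w0; apply: contrapT => /forallNP large.
have : lip_min (lip_abs w) (lip1 d) = lip1 d.
  apply: val_inj; apply/funext => x /=; apply/min_idPr.
  by rewrite mulN1r maxrN leNgt; exact/negP/large.
move/(congr1 phi); rewrite pm pM pZ w0 p1 mulr0 maxxx.
by rewrite min_l ?ler01// => /eqP; rewrite eq_sym oner_eq0.
Qed.

(** The sets [|w| < 1] for [w] in the kernel of [phi] form the base of a proper
filter on [X]: they are nonempty, and the maximum of [|v|] and [|w|] is again in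
the kernel. Along this filter each [u] tends to [phi u], because
[(u - phi u) / r] is in the kernel for every [r > 0]; so the evaluations
converge to [phi]. *)
Lemma hom_sub_closure phi : is_unital_vlattice_hom phi ->
  closure (range (@lip_eval R X d)) phi.
Proof.
move=> hphi; have [p1 pD pZ pM pm] := hphi.
pose G := filter_from [set w | phi w = 0] (fun w => [set x | `|val w x| < 1]).
have GP : ProperFilter G.
  apply: filter_from_proper; last by move=> w; exact: hom_meets_small.
  apply: filter_from_filter.
    by exists (lipZ 0 (lip1 d)); rewrite /= pZ mul0r.
  move=> v w /= v0 w0; exists (lip_max (lip_abs v) (lip_abs w)).
    by rewrite !pM !pZ v0 w0 mulr0 !maxxx.
  move=> x /=; rewrite !mulN1r !maxrN ger0_norm ?le_max ?normr_ge0//.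
  by rewrite gt_max => /andP[].
have evphi : @lip_eval R X d @ G --> phi.
  apply: cvg_ptws => u; apply/cvgrPdist_lt => r r0.
  exists (lipZ r^-1 (lipD u (lipZ (- phi u) (lip1 d)))).
    by rewrite /= pZ pD pZ p1 mulr1 subrr mulr0.
  move=> x /=; rewrite mulr1 normrM gtr0_norm ?invr_gt0//.
  by rewrite ltr_pdivrMl// mulr1 distrC.
move=> B /evphi Bphi; have [x Bx] := filter_ex (F := G) Bphi.
by exists (lip_eval x); split=> //; exists x.
Qed.

Lemma closure_sub_hom phi : closure (range (@lip_eval R X d)) phi ->
  is_unital_vlattice_hom phi.
Proof.
move=> cphi; have ev u := @eval_continuous R (Lip d) u.
have eqs (f g : {ptws Lip d -> R} -> R) : continuous f -> continuous g ->
    (forall x, f (lip_eval x) = g (lip_eval x)) -> f phi = g phi.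
  by move=> cf cg fg; exact: closure_range_eq cf cg fg cphi.
split=> [|u v|a u|u v|u v].
- apply: (eqs (fun q => q (lip1 d)) (fun=> 1)) => //.
  by move=> q; exact: cst_continuous.
- apply: (eqs (fun q => q (lipD u v)) (fun q => q u + q v)) => // q.
  exact: cvgD (ev u q) (ev v q).
- apply: (eqs (fun q => q (lipZ a u)) (fun q => a * q u)) => // q.
  exact: cvgMr (ev u q).
- apply: (eqs (fun q => q (lip_max u v)) (fun q => Num.max (q u) (q v))) => // q.
  exact: continuous_max (ev u q) (ev v q).
- apply: (eqs (fun q => q (lip_min u v)) (fun q => Num.min (q u) (q v))) => // q.
  exact: continuous_min (ev u q) (ev v q).
Qed.

Lemma hom_closure :
  [set phi : {ptws Lip d -> R} | is_unital_vlattice_hom phi] =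
  closure (range (@lip_eval R X d)).
Proof.
by apply/seteqP; split=> phi; [exact: hom_sub_closure|exact: closure_sub_hom].
Qed.

End LipHom.

(** * Metrics inducing the topology *)

Section CompatibleMetric.
Variables (R : realType) (X : topologicalType) (d : X -> X -> R).
Hypotheses (dm : is_metric d) (dt : induces_topology d).

Lemma metric_nbhs x (r : R) : 0 < r -> nbhs x [set y | d x y < r].
Proof.
case: dm => d0 dxx dC dT r0.
apply: open_nbhs_nbhs; split; last by rewrite /= (dxx x x).2.
apply/dt => y /= xy; exists (r - d x y); first by rewrite subr_gt0.
by move=> z /= yz; have := dT x y z; lra.
Qed.

Lemma lipschitz_continuous f : is_lipschitz d f -> continuous f.
Proof.
move=> [K fK] x; apply/cvgrPdist_lt => r r0.
have K0 : 0 < `|K| + 1 by rewrite ltr_wpDl.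
apply: filterS (metric_nbhs x (divr_gt0 r0 K0)) => y /=.
rewrite ltr_pdivlMr// => dr.
have [d0 _ _ _] := dm; have Kd : K * d x y <= `|K| * d x y.
  by rewrite ler_wpM2r ?ler_norm.
by have := fK x y; have := d0 x y; lra.
Qed.

Lemma dist_lipschitz a : is_lipschitz d (d a).
Proof.
case: dm => d0 dxx dC dT; exists 1 => x y; rewrite mul1r ler_norml.
by have := dT a x y; have := dT a y x; rewrite (dC y x); lra.
Qed.

Lemma dist_separates x y : d x x = d x y -> x = y.
Proof. by case: dm => _ dxx _ _; rewrite (dxx x x).2// => /esym/dxx. Qed.

Lemma dist_base (A : set X) x : open A -> A x ->
  exists2 r : R, 0 < r & forall y, `|d x x - d x y| < r -> A y.
Proof.
case: dm => d0 dxx _ _ /dt/[apply] -[r r0 rA]; exists r => // y.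
by rewrite (dxx x x).2// sub0r normrN ger0_norm//; exact: rA.
Qed.

Definition graph_metric (f : X -> R) x y := d x y + `|f x - f y|.

Lemma graph_metric_is_metric f : is_metric (graph_metric f).
Proof.
case: dm => d0 dxx dC dT; rewrite /graph_metric; split=> [x y|x y|x y|x y z].
- by rewrite addr_ge0.
- split=> [|<-]; last by rewrite subrr normr0 addr0; exact/dxx.
  by move=> H; apply/dxx; have := d0 x y; have := normr_ge0 (f x - f y); lra.
- by rewrite dC distrC.
- by have := dT x y z; have := ler_distD (f y) (f x) (f z); lra.
Qed.

(** The distance of the graph of [f] in the product of [X] and the real line,
with the sum metric; continuity of [f] makes [X] homeomorphic to this graph. *)
Lemma graph_metric_induces f :
  continuous f -> induces_topology (graph_metric f).
Proof.
move=> cf A; split=> [/dt oA x /oA[r r0 rA]|gA].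
  exists r => // y /= H; apply: rA => /=.
  by apply: le_lt_trans H; rewrite lerDl.
rewrite openE => x /gA[r r0 rA].
have r2 : 0 < r / 2 by rewrite divr_gt0.
have /cvgrPdist_lt/(_ _ r2) fr := cf x.
apply: filterS (filterI (metric_nbhs x r2) fr) => y /= [dxy fxy].
by apply: rA; rewrite /graph_metric /=; lra.
Qed.

Lemma graph_metric_lipschitz f : is_lipschitz (graph_metric f) f.
Proof.
by exists 1 => x y; case: dm => d0 _ _ _; rewrite mul1r lerDr.
Qed.

(** * The Lipschitz and Hewitt-Nachbin realcompactifications *)

Lemma HLip_realcompactification :
  is_realcompactification R (lipschitz_realcompactification d).
Proof.
apply: (closure_realcompactification (F := fun u : Lip d => val u)).
- by move=> u; apply: lipschitz_continuous; exact: set_valP.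
- exact: hom_closure.
- by [].
- by move=> x y /(_ (mkLip (dist_lipschitz x)))/dist_separates.
- move=> A x oA /(dist_base oA)[r r0 rA].
  by exists (mkLip (dist_lipschitz x)), r.
Qed.

Lemma HLip_extends_to f : is_lipschitz d f ->
  extends_to (lipschitz_realcompactification d) f.
Proof.
move=> lf.
exact: (@closure_extends_to R X (Lip d) (fun u : Lip d => val u) _
  (@HLip_eval R X d) _ (mkLip lf)).
Qed.

Lemma HLip_le Z : dense (range (@ext_map X Z)) ->
  (forall f : X -> R, continuous f -> extends_to Z f) ->
  ext_le (lipschitz_realcompactification d) Z.
Proof.
move=> Zd Zf.
apply: (closure_ext_le (F := fun u : Lip d => val u)) => //.
  exact: hom_closure.
by move=> u; apply: Zf; apply: lipschitz_continuous; exact: set_valP.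
Qed.

(** The closure of [X] in the power of the real line indexed by all continuous
functions; among these, the functions [d a] make the evaluation map an
embedding. *)
Lemma hewitt_nachbin_exists : exists U : extension X, is_hewitt_nachbin R U.
Proof.
pose I := {f : X -> R | continuous f}.
pose F (i : I) := projT1 i.
have Fc i : continuous (F i) by exact: projT2 i.
pose ev (x : X) : {ptws I -> R} := fun i => F i x.
have evC x : closure (range ev) (ev x) by apply: subset_closure; exists x.
pose e (x : X) : set_type (closure (range ev)) := SigSub (mem_set (evC x)).
pose D x : I := exist _ (d x) (lipschitz_continuous (dist_lipschitz x)).
exists (Extension e); split.
- apply: (closure_realcompactification (F := F)) => //.
    by move=> x y /(_ (D x))/dist_separates.
  by move=> A x oA /(dist_base oA)[r r0 rA]; exists (D x), r.
- by move=> f cf; exact: (closure_extends_to (F := F) (e := e) _ (exist _ f cf)).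
- move=> Z [_ _ _ Zd] Zf; apply: (closure_ext_le (F := F)) => // i.
  exact/Zf/Fc.
Qed.

End CompatibleMetric.

Lemma extends_to_le (R : realType) (X : topologicalType) (Y Z : extension X)
  (f : X -> R) : ext_le Y Z -> extends_to Y f -> extends_to Z f.
Proof.
move=> [h [ch hE]] [g [cg gE]]; exists (g \o h); split=> [z|x].
  by apply: continuous_comp; [exact: ch | exact: cg].
by rewrite /= hE gE.
Qed.

Theorem mainTheorem4 (R : realType) (X : topologicalType)
    (hX : metrizable R X) :
  (exists U : extension X, is_hewitt_nachbin R U) /\
  (forall U : extension X,
     is_hewitt_nachbin R U <->
     is_supremum R
       (fun Y : extension X =>
          exists d : X -> X -> R,
            [/\ is_metric d, induces_topology d
              & Y = lipschitz_realcompactification d]) U).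
Proof.
have [d [dm dt]] := hX.
split=> [|U]; first exact: hewitt_nachbin_exists dm dt.
(* An upper bound of the Lipschitz realcompactifications extends every
   continuous [f], because [f] is Lipschitz for [graph_metric d f]. *)
have extW (W : extension X) :
    (forall Z : extension X, (exists d : X -> X -> R,
      [/\ is_metric d, induces_topology d
        & Z = lipschitz_realcompactification d]) -> ext_le Z W) ->
    forall f : X -> R, continuous f -> extends_to W f.
  move=> HW f cf.
  apply: (extends_to_le (Y := lipschitz_realcompactification
    (graph_metric d f))).
    apply: HW; exists (graph_metric d f); split=> //.
      exact: graph_metric_is_metric.
    exact: graph_metric_induces.
  exact/HLip_extends_to/graph_metric_lipschitz.
split=> [[Urc Uext Umin]|[_ Urc Uub Ulub]]; split=> //.
- by move=> _ [d' [d'm d't ->]]; exact: HLip_realcompactification.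
- move=> _ [d' [d'm d't ->]]; have [_ _ _ Ud] := Urc.
  exact: HLip_le.
- by move=> W Wrc HW; apply: Umin => //; exact: extW.
- exact: extW.
- move=> Z Zrc Zext; apply: Ulub => // _ [d' [d'm d't ->]].
  by have [_ _ _ Zd] := Zrc; exact: HLip_le.
Qed.
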